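(* Let $g\in\mathrm{BV}((0,1);[0,1])$ be a non-decreasing function with $g\equiv0$ on $(0,\delta)$ and $g\equiv1$ on $(1-\delta,1)$ for some $\delta\in(0,1/2)$, and let $\lambda,\gamma>0$, $p\in[1,\infty]$. If $\gamma\le1$ and $\lambda\delta^{\gamma/p}>2$, then $u=g$ is the unique minimizer (uniqueness being understood up to equality almost everywhere) of the functional $F:\mathrm{BV}((0,1))\to\mathbb{R}$ given by $$F(u)=\mathrm{TV}(u)+\lambda\|u-g\|_p^\gamma .$$
   Context: For an interval $I$ and $u:I\to\mathbb{R}$, $\mathrm{TV}(u)=\mathrm{TV}(u;I)$ is the pointwise total variation, i.e. the supremum of $\sum_{i=1}^n|u(x_i)-u(x_{i-1})|$ over finite sequences $x_0\le\dots\le x_n$ in $I$. $\mathrm{BV}(I)$ is the set of functions $u:I\to\mathbb{R}$ with $\mathrm{TV}(u;I)<\infty$, and $\mathrm{BV}(I;[0,1])$ those with values in $[0,1]$. $\|\cdot\|_p$ is the $L^p$ norm on $(0,1)$. When $p=\infty$, $\gamma/p$ is interpreted as $0$. *)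

(* Defs.v *)
From HB Require Import structures.
From mathcomp Require Import all_boot all_order all_algebra.
From mathcomp Require Import all_classical all_reals all_analysis.
Set Implicit Arguments.
Unset Strict Implicit.
Unset Printing Implicit Defensive.
Import Order.TTheory GRing.Theory Num.Theory.
Import numFieldNormedType.Exports.
Local Open Scope classical_set_scope.
Local Open Scope ring_scope.

(* Functions on an interval I are represented by functions R -> R, of which
   only the values on I matter in the definitions below. *)

(* The library's [total_variation] is for closed intervals `[a, b] only, with
   partitions that contain a and b; here I may be open. *)
Definition pointwise_tv (R : realType) (I : interval R) (u : R -> R) : \bar R :=
  ereal_sup [set v | exists (n : nat) (x : nat -> R),
    [/\ forall i, (i <= n)%N -> x i \in I,
        forall i, (i < n)%N -> x i <= x i.+1 &
        v = (\sum_(1 <= i < n.+1) `|u (x i) - u (x i.-1)|)%:E]].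

Definition bv (R : realType) (I : interval R) : set (R -> R) :=
  [set u | (pointwise_tv I u < +oo)%E].

Definition bv_in (R : realType) (I J : interval R) : set (R -> R) :=
  [set u | bv I u /\ forall x, x \in I -> u x \in J].

(* Extending u by 0 outside of I changes neither the integral of |u|^p over I
   (p >= 1) nor, when I has positive measure, the essential supremum of |u|
   on I. *)
Definition lp_norm (R : realType) (I : interval R) (p : \bar R) (u : R -> R) :
    \bar R :=
  'N[@lebesgue_measure R]_p[EFin \o (u \_ [set` I])%R]%E.

(* gamma / p, which is 0 for p = +oo; the value at -oo is irrelevant. *)
Definition expo_div (R : realType) (gamma : R) (p : \bar R) : R :=
  if p is r%:E then gamma / r else 0.

(* Extended-real valued; it is finite on BV((0,1)) when lambda, gamma > 0 and
   1 <= p, as functions of bounded variation are bounded. *)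
Definition tv_functional (R : realType) (lambda gamma : R) (p : \bar R)
    (g u : R -> R) : \bar R :=
  (pointwise_tv `]0%R, 1%R[ u
   + lambda%:E * (lp_norm `]0%R, 1%R[ p (u \- g)%R) `^ gamma)%E.

Definition minimizes (R : realType) (A : set (R -> R))
    (F : (R -> R) -> \bar R) (u : R -> R) : Prop :=
  A u /\ forall v, A v -> (F u <= F v)%E.

(* Main.v *)
(* TV g <= 1, so it suffices to show F u >= 1, and F u > 1 when TV u < 1. Put
   a := 1 - TV u > 0. Since u varies by at most 1 - a, it cannot be a/2-close
   both to 0 somewhere on ]0, delta[ and to 1 somewhere on ]1 - delta, 1[, so
   |u - g| >= a/2 on one of these two intervals and
   lambda |u - g|_p^gamma >= lambda delta^(gamma/p) (a/2)^gamma > 2 (a/2) = a,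
   where gamma <= 1 and a/2 <= 1 give (a/2)^gamma >= a/2. If TV u >= 1 and
   F u <= 1, then the norm vanishes, and u = g almost everywhere because
   functions of bounded variation are measurable. *)
Require Import Defs.
From HB Require Import structures.
From mathcomp Require Import all_boot all_order all_algebra.
From mathcomp Require Import all_classical all_reals all_analysis.
From mathcomp Require Import measurable_realfun ess_sup_inf lra.
Set Implicit Arguments.
Unset Strict Implicit.
Unset Printing Implicit Defensive.
Import Order.TTheory GRing.Theory Num.Theory.
Import numFieldNormedType.Exports.
Local Open Scope classical_set_scope.
Local Open Scope ring_scope.

(** * Pointwise variation: telescoping, superadditivity, measurability *)

Section PointwiseVariation.
Context {R : realType}.
Implicit Types (I : interval R) (u : R -> R) (x y : R).

Lemma pointwise_tv_ge0 I u x : x \in I -> (0 <= pointwise_tv I u)%E.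
Proof.
move=> xI; apply: ereal_sup_ubound; exists 0%N, (fun=> x); split => //.
by rewrite big_nil.
Qed.

Lemma pointwise_tv_ge_dist I u x y : x \in I -> y \in I -> x <= y ->
  (`|u y - u x|%:E <= pointwise_tv I u)%E.
Proof.
move=> xI yI xy; apply: ereal_sup_ubound.
exists 1%N, (fun i => if i is 0 then x else y); split => [[|i]|[|i]|] //.
by rewrite big_nat1.
Qed.

Lemma le_pointwise_tv I J u : {subset I <= J} ->
  (pointwise_tv I u <= pointwise_tv J u)%E.
Proof.
move=> IJ; apply: ereal_sup_le => v [n [t [tI tnd ->]]].
by exists n, t; split=> // i /tI /IJ.
Qed.

(** Increments of a monotone function are non-negative, so each sum telescopes to the difference of
    [u] between the last and the first point. A uniform [c] replaces endpoint values, since [I] may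
    be open. *)
Lemma pointwise_tv_ndecr I u (c : R) : {in I &, nondecreasing_fun u} ->
  {in I &, forall x y, u y - u x <= c} -> (pointwise_tv I u <= c%:E)%E.
Proof.
move=> u_nd uc; apply: ge_ereal_sup => v [n [x [xI x_nd ->]]].
rewrite lee_fin (@eq_big_nat _ _ _ _ _ _ (fun i => u (x i) - u (x i.-1))).
  rewrite big_add1/= telescope_sumr//.
  by apply: uc; exact: xI.
move=> [//|i]; rewrite ltnS => /andP[_ ltin] /=.
by rewrite ger0_norm// subr_ge0 u_nd ?x_nd ?xI// ltnW.
Qed.

(** A partition that stays below [x] can be prolonged by [x] and [y], which adds at least
    [|u y - u x|] to its sum. *)
Lemma pointwise_tv_superadd (i : itv_bound R) u x y :
  (i <= BLeft x)%O -> x <= y ->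
  (pointwise_tv (Interval i (BRight x)) u + `|u y - u x|%:E <=
   pointwise_tv (Interval i (BRight y)) u)%E.
Proof.
move=> ix xy; rewrite -leeBrDr//; apply: ge_ereal_sup => v [n [t [tI tnd ->]]].
rewrite leeBrDr//.
(* The prolonged partition: [t 0], ..., [t n], then [x] at index [n.+1] and [y] at [n.+2]. *)
pose s k := if (k <= n)%N then t k else if k == n.+1 then x else y.
have sn : s n = t n by rewrite /s leqnn.
have sx : s n.+1 = x by rewrite /s ltnn eqxx.
have sy : s n.+2 = y by rewrite /s ltnNge leqnSn gtn_eqF.
have tx k : (k <= n)%N -> t k <= x by move=> /tI; rewrite itv_boundlr => /andP[].
have iy : (i <= BLeft y)%O by rewrite (le_trans ix).
apply: (@le_trans _ _ (\sum_(1 <= k < n.+3) `|u (s k) - u (s k.-1)|)%:E).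
  rewrite (@big_nat_recr _ _ _ n.+2)//= (@big_nat_recr _ _ _ n.+1)//= sn sx sy.
  rewrite -EFinD lee_fin lerD2r.
  (* The term for the step from [t n] to [x] is only bounded below by 0; all earlier terms agree. *)
  rewrite -[leLHS]addr0 lerD// le_eqVlt; apply/orP; left; apply/eqP.
  apply: eq_big_nat => k /andP[k0 kn]; rewrite /s.
  by rewrite -ltnS kn (leq_trans (leq_pred _))// -ltnS.
apply: ereal_sup_ubound; exists n.+2, s; split => // k.
- move=> _; rewrite /s; case: ifPn => [/tI|_].
    by rewrite !itv_boundlr/= => /andP[-> /le_trans]; apply.
  by case: ifPn => _; rewrite itv_boundlr ?ix ?iy !bnd_simp ?lexx ?xy.
- rewrite !ltnS leq_eqVlt => /predU1P[->|]; first by rewrite sx sy.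
  rewrite ltnS leq_eqVlt => /predU1P[->|kn]; first by rewrite sn sx tx.
  by rewrite /s (ltnW kn) kn tnd.
Qed.

(** By monotonicity, the part of [I] where [u] is at least [r] is order-convex, hence an interval;
    the rays [[r, +oo[] generate the Borel sets. *)
Lemma nondecreasing_in_measurable I u :
  {in I &, nondecreasing_fun u} -> measurable_fun [set` I] u.
Proof.
move=> u_nd.
apply: (measurability (@RGenCInfty.G R)) => [|/= _ [_] [r] -> <-].
  exact: RGenCInfty.measurableE.
apply: is_interval_measurable => s t /= [sI us] [tI ut] x sxt.
have xI : x \in I := @interval_is_interval R I s t sI tI x sxt.
move: us; rewrite in_itv/= andbT => us.
split => //=; rewrite in_itv/= andbT (le_trans us)// u_nd//.
by case/andP: sxt.
Qed.

(* Jordan decomposition: with [T x] the variation of [u] up to [x], both [T]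
   and [T - u] are nondecreasing. *)
Lemma bv_measurable I u : bv I u -> measurable_fun [set` I] u.
Proof.
case: I => i j uI; set I := Interval i j in uI *.
pose T x := fine (pointwise_tv (Interval i (BRight x)) u).
have Tfin x : x \in I -> pointwise_tv (Interval i (BRight x)) u \is a fin_num.
  move=> xI; rewrite ge0_fin_numE; last first.
    apply: (@pointwise_tv_ge0 _ _ x); move: xI.
    by rewrite !itv_boundlr => /andP[->]/=.
  apply: le_lt_trans uI; apply: le_pointwise_tv => y; move: xI.
  rewrite !itv_boundlr => /andP[_ xj] /andP[->] /=.
  by move=> /le_trans; apply.
(* Dropping the absolute value gives monotonicity of [T]; bounding it below by [u y - u x] gives
   that of [T - u]. *)
have Tuu : {in I &, forall x y, x <= y -> T x + `|u y - u x| <= T y}.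
  move=> x y xI yI xy; rewrite -lee_fin EFinD !fineK ?Tfin//.
  by apply: pointwise_tv_superadd => //; move: xI; rewrite itv_boundlr => /andP[].
have -> : u = T \- (T \- u) by apply/funext => x /=; lra.
apply: measurable_funB; apply: nondecreasing_in_measurable => x y xI yI xy /=.
  by have := Tuu _ _ xI yI xy; apply: le_trans; rewrite lerDl.
have := Tuu _ _ xI yI xy; have := ler_norm (u y - u x); lra.
Qed.

End PointwiseVariation.

(** * Norms over an interval *)

Section LpNorm.
Context {R : realType}.
Implicit Types (I : interval R) (u : R -> R) (p : \bar R).

Lemma lp_norm_self I p u : (1 <= p)%E -> lp_norm I p (u \- u) = 0%E.
Proof.
move=> p1; rewrite /lp_norm (@eq_Lnorm _ _ _ _ _ _ (cst 0%E)) ?Lnorm0//.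
  by rewrite gt_eqF// (lt_le_trans _ p1).
by move=> x /=; rewrite patchE /= subrr if_same.
Qed.

Lemma lp_norm_ge0 I p u : (0 <= lp_norm I p u)%E.
Proof. exact: Lnorm_ge0. Qed.

Lemma lp_norm_eq0 I p u : (1 <= p)%E -> measurable_fun [set` I] u ->
  lp_norm I p u = 0%E ->
  {ae @lebesgue_measure R, forall x, x \in I -> u x = 0}.
Proof.
move=> p1 mu /Lnorm_eq0_eq0 u0.
have : (EFin \o u \_ [set` I]) = \0%E %[ae @lebesgue_measure R].
  apply: u0; last exact: lt_le_trans p1.
  by apply/measurable_EFinP; apply/(measurable_restrictT _ _).1.
apply: (@filterS _ _ (ae_filter_ringOfSetsType _)) => x /= /(_ Logic.I) [+] xI.
by rewrite patchE mem_set.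
Qed.

(** Chebyshev's inequality; [expo_div 1 p] is 1/p, read as 0 for infinite [p]. *)
Lemma lp_norm_ge I p u (A : set R) (c d : R) : (1 <= p)%E ->
  measurable_fun [set` I] u -> measurable A -> A `<=` [set` I] ->
  lebesgue_measure A = d%:E -> 0 < d -> 0 <= c ->
  (forall x, A x -> c <= `|u x|) ->
  ((c * d `^ expo_div 1 p)%:E <= lp_norm I p u)%E.
Proof.
move=> p1 mu mA AI Ad d0 c0 cu; rewrite /lp_norm unlock.
have uA x : A x -> c <= `|(u \_ [set` I]) x|.
  by move=> Ax; rewrite patchE mem_set ?cu//; exact: AI.
case: p p1 => [r||//] p1; last first.
  rewrite /= powRr0 mulr1.
  (* For infinite [p] the norm is the essential supremum provided that the whole space has positive
     measure. *)
  have muT : (0 < @lebesgue_measure R setT)%E.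
    apply: (@lt_le_trans _ _ (lebesgue_measure A)); first by rewrite Ad lte_fin.
    by rewrite le_measure ?inE.
  rewrite muT leNgt; apply/negP => uc.
  (* If the essential supremum were below [c], then [A] would lie in the null set where [|u|]
     exceeds it. *)
  suff : lebesgue_measure A = 0%E by rewrite Ad => -[d00]; rewrite d00 ltxx in d0.
  apply: (@negligibleP _ _ _ lebesgue_measure A mA).1.
  have := @ess_sup_ge _ _ R (@lebesgue_measure R)
    (abse \o (EFin \o u \_ [set` I])).
  apply: negligibleS => x Ax /=; apply/negP; rewrite -ltNge.
  by apply: lt_le_trans uc _; rewrite lee_fin uA.
have r0 : 0 < r by rewrite (lt_le_trans ltr01).
rewrite /= div1r.
(* In this form the outer power 1/r can be removed by monotonicity, and [c ^ r * d] is the integral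
   of a constant over [A]. *)
have -> : (c * d `^ r^-1)%:E = ((c `^ r * d)%:E `^ r^-1)%E.
  rewrite poweR_EFin powRM ?powR_ge0 ?(ltW d0)// -powRrM mulfV ?gt_eqF//.
  by rewrite powRr1.
have mup : measurable_fun setT (fun x => (`|(u \_ [set` I]) x| `^ r)%:E).
  apply/measurable_EFinP; apply: (measurableT_comp (measurable_powR r)) => //.
  apply: measurableT_comp => //.
  exact/(measurable_restrictT _ _).1.
apply: gt0_ler_poweR; rewrite ?in_itv/= ?invr_ge0 ?(ltW r0) ?leey ?andbT//.
- by rewrite lee_fin mulr_ge0 ?powR_ge0 ?(ltW d0).
- by apply: integral_ge0 => x _; rewrite lee_fin powR_ge0.
apply: (@le_trans _ _ (\int[lebesgue_measure]_(x in A)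
    (`|(u \_ [set` I]) x| `^ r)%:E)%E).
  rewrite EFinM -Ad -integral_cst//.
  apply: ge0_le_integral => //.
  - by move=> x _; rewrite lee_fin powR_ge0.
  - exact: measurable_funTS.
  - move=> x Ax; rewrite /= lee_fin ge0_ler_powR ?nnegrE ?(ltW r0)//.
    exact: uA.
by apply: ge0_subset_integral => // x _; rewrite lee_fin powR_ge0.
Qed.

End LpNorm.

Lemma expo_divE {R : realType} (gamma : R) p :
  expo_div 1 p * gamma = expo_div gamma p.
Proof. by case: p => [r||] /=; rewrite ?mul0r// mulrAC mul1r. Qed.

(** * Lower bound for the functional when the variation is below 1 *)

Section LowerBound.
Context {R : realType}.
Variables (g u : R -> R) (delta lambda gamma : R) (p : \bar R).
Hypotheses (delta_itv : delta \in `]0, 1 / 2[)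
  (g_left : forall x : R, x \in `]0, delta[ -> g x = 0)
  (g_right : forall x : R, x \in `]1 - delta, 1[ -> g x = 1)
  (mug : measurable_fun (`]0, 1[%classic : set R) (u \- g)).

Lemma lp_norm_sub_ge (a : R) : (1 <= p)%E -> 0 <= a ->
  (pointwise_tv `]0%R, 1%R[ u <= (1 - a)%:E)%E ->
  ((a / 2 * delta `^ expo_div 1 p)%:E <= lp_norm `]0%R, 1%R[ p (u \- g)%R)%E.
Proof.
move=> p1 a0 ua; move: (delta_itv); rewrite in_itv/= => /andP[d0 d12].
have a20 : 0 <= a / 2 by rewrite divr_ge0.
(* Either [u] stays away from 0 on the whole left interval, or some [x] there has [|u x| < a / 2],
   and this single point controls [u] on the right interval. *)
have [ul|/existsNP[x /not_implyP[xd /negP]]] := pselect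
    (forall x, x \in `]0, delta[ -> a / 2 <= `|u x|).
  apply: (@lp_norm_ge _ _ _ _ `]0, delta[%classic) => //.
  - by move=> x /=; rewrite !in_itv/= => /andP[-> xd]; lra.
  - by rewrite lebesgue_measure_itv/= lte_fin d0 sube0.
  - by move=> x /= xd; rewrite g_left// subr0 ul.
rewrite -ltNge => uxa.
apply: (@lp_norm_ge _ _ _ _ `]1 - delta, 1[%classic) => //.
- by move=> y /=; rewrite !in_itv/= => /andP[yd ->]; lra.
- rewrite lebesgue_measure_itv/= lte_fin ltrBlDr ltrDl d0 -EFinB.
  by congr EFin; lra.
- move=> y /= yd; rewrite g_right//.
  have /le_trans/(_ ua) : (`|u y - u x|%:E <= pointwise_tv `]0%R, 1%R[ u)%E.
    move: xd yd; rewrite !in_itv/= => /andP[? ?] /andP[? ?].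
    by apply: pointwise_tv_ge_dist; rewrite ?in_itv/=; lra.
  (* From [u y <= u x + (1 - a)] and [u x < a / 2] follows [1 - u y > a / 2]. *)
  rewrite lee_fin; have := ler_norm (u y - u x); have := ler_norm (u x).
  have := ler_norm (- (u y - 1)); rewrite normrN; lra.
Qed.

Lemma tv_functional_gt1 : 0 < lambda -> 0 < gamma -> (1 <= p)%E ->
  gamma <= 1 -> 2 < lambda * delta `^ expo_div gamma p ->
  (pointwise_tv `]0%R, 1%R[ u < 1)%E ->
  (1 < tv_functional lambda gamma p g u)%E.
Proof.
move=> lambda0 gamma0 p1 gamma1 ld u1; rewrite /tv_functional.
have half01 : (1 / 2 : R) \in `]0, 1[ by rewrite in_itv/=; lra.
have u0 := pointwise_tv_ge0 u half01.
have ufin : pointwise_tv `]0, 1[ u \is a fin_num.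
  by rewrite ge0_fin_numE// (lt_trans u1) ?ltry.
(* For this choice of [a], the bound on the variation required by [lp_norm_sub_ge] is an
   equality. *)
move: u0 u1 (@lp_norm_sub_ge (1 - fine (pointwise_tv `]0%R, 1%R[ u)) p1).
rewrite -(fineK ufin)/=; set t := fine _; rewrite !lee_fin lte_fin => t0 t1.
rewrite subr_ge0 (ltW t1) => /(_ isT); rewrite subKr lexx => /(_ isT).
set a := 1 - t => aN; move: (delta_itv); rewrite in_itv/= => /andP[d0 _].
have a0 : 0 < a by rewrite subr_gt0.
have a2N : ((a / 2 * delta `^ expo_div gamma p)%:E <=
    lp_norm `]0%R, 1%R[ p (u \- g)%R `^ gamma)%E.
  apply: (@le_trans _ _ ((a / 2 * delta `^ expo_div 1 p)%:E `^ gamma)%E).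
    rewrite poweR_EFin powRM ?powR_ge0 ?divr_ge0 ?(ltW a0)//.
    rewrite -powRrM expo_divE lee_fin ler_wpM2r ?powR_ge0//.
    by rewrite ger1_powR//; rewrite /a; lra.
  apply: gt0_ler_poweR; rewrite ?(ltW gamma0) ?in_itv/= ?leey ?andbT//.
  - by rewrite lee_fin mulr_ge0 ?powR_ge0 ?divr_ge0 ?(ltW a0).
  - exact: lp_norm_ge0.
apply: (@lt_le_trans _ _
  (t%:E + lambda%:E * (a / 2 * delta `^ expo_div gamma p)%:E)%E).
  rewrite -EFinM -EFinD lte_fin mulrCA.
  have : a / 2 * 2 < a / 2 * (lambda * delta `^ expo_div gamma p).
    by rewrite ltr_pM2l// divr_gt0.
  by rewrite /a; lra.
by rewrite leeD2l// lee_pmul2l.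
Qed.

End LowerBound.

(** * Minimality and uniqueness of [g] *)

Theorem theorem3p7 (R : realType) (g : R -> R) (delta lambda gamma : R)
    (p : \bar R)
    (g_bv : bv_in `]0, 1[ `[0, 1] g)
    (g_nondecreasing : {in `]0, 1[ &, nondecreasing_fun g})
    (delta_itv : delta \in `]0, 1 / 2[)
    (g_left : forall x : R, x \in `]0, delta[ -> g x = 0)
    (g_right : forall x : R, x \in `]1 - delta, 1[ -> g x = 1)
    (lambda_gt0 : 0 < lambda) (gamma_gt0 : 0 < gamma) (p_ge1 : (1 <= p)%E)
    (gamma_le1 : gamma <= 1)
    (lambda_delta : 2 < lambda * delta `^ (expo_div gamma p)) :
  minimizes (bv `]0, 1[) (tv_functional lambda gamma p g) g /\
  forall u, minimizes (bv `]0, 1[) (tv_functional lambda gamma p g) u ->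
    {ae @lebesgue_measure R, forall x : R, x \in `]0, 1[ -> u x = g x}.
Proof.
have [g_bv1 g01] := g_bv.
have Fg : (tv_functional lambda gamma p g g <= 1)%E.
  (* The penalty vanishes at [g] because [gamma] is nonzero, so that 0 to the power [gamma] is 0. *)
  rewrite /tv_functional lp_norm_self// poweR0r ?gt_eqF// mule0 adde0.
  apply: pointwise_tv_ndecr => // x y /g01 + /g01.
  by rewrite !in_itv/= => /andP[? ?] /andP[? ?]; lra.
have mug u : bv `]0, 1[ u -> measurable_fun (`]0, 1[%classic : set R) (u \- g).
  by move=> /bv_measurable mu; apply: measurable_funB; last exact: bv_measurable.
have F_tv u : (pointwise_tv `]0%R, 1%R[ u <= tv_functional lambda gamma p g u)%E.
  by rewrite leeDl// mule_ge0 ?poweR_ge0// lee_fin; exact: ltW.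
have F_gt1 u : bv `]0, 1[ u -> (pointwise_tv `]0%R, 1%R[ u < 1)%E ->
    (1 < tv_functional lambda gamma p g u)%E.
  by move=> /mug mu u1; exact: (tv_functional_gt1 delta_itv g_left g_right mu).
split.
  split=> // v v_bv; apply: (le_trans Fg).
  have [v1|/(F_gt1 _ v_bv)] := leP 1%E (pointwise_tv `]0%R, 1%R[ v).
    exact: le_trans (F_tv v).
  exact: ltW.
move=> u [u_bv /(_ g g_bv1) /le_trans /(_ Fg) Fu].
have u1 : (1 <= pointwise_tv `]0%R, 1%R[ u)%E.
  by rewrite leNgt; apply/negP => /(F_gt1 _ u_bv); rewrite ltNge Fu.
have N0 : lp_norm `]0%R, 1%R[ p (u \- g)%R = 0%E.
  apply: (@poweR_eq0_eq0 _ _ gamma); first exact: lp_norm_ge0.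
  apply/eqP; rewrite eq_le poweR_ge0 andbT.
  (* Replacing the variation by its lower bound 1 and cancelling the finite 1 leaves a penalty that
     is at most 0. *)
  have : (1 + lambda%:E * lp_norm `]0%R, 1%R[ p (u \- g)%R `^ gamma <= 1 + 0)%E.
    by rewrite adde0; apply: le_trans Fu; rewrite leeD2r.
  by rewrite leeD2lE// pmule_rle0.
have := lp_norm_eq0 p_ge1 (mug u u_bv) N0.
apply: (@filterS _ _ (ae_filter_ringOfSetsType _)) => x /= ugx xI.
by have /eqP := ugx xI; rewrite subr_eq0 => /eqP.
Qed.
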